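(* Let $n \geq 24$, and let \[ L = \{0, 2, 3, 7, 8, 9, 10\}, \qquad R = \{n-11, n-10, n-9, n-8, n-6, n-3, n-2, n-1\}. \] Let $M$ be a subset of $[11, n-12]$ with the property that every prefix and every suffix of the interval $[11, n-12]$ has more than half of its elements in $M$. Then $S = L \cup M \cup R$ is an MSTD set. The number of MSTD subsets of $\{0, 1, \dots, n-1\}$ obtained in this way (as $M$ ranges over all such subsets) is $\Theta(2^n/n)$.
   Context: For integers $a \le b$, $[a,b]$ denotes the set $\{a, a+1, \dots, b\}$. A more sums than differences (MSTD) set is a finite set $S$ of integers with $|S+S| > |S-S|$, where $S+S = \{s_1+s_2 : s_1,s_2\in S\}$ and $S-S = \{s_1-s_2 : s_1,s_2\in S\}$. A prefix of $[11, n-12]$ is an interval $[11, 10+k]$ and a suffix is an interval $[n-11-k, n-12]$, for $1 \le k \le n-22$. *)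

(* Defs.v *)
From mathcomp Require Import all_boot all_order all_algebra.
Set Implicit Arguments. Unset Strict Implicit. Unset Printing Implicit Defensive.
Import Order.TTheory GRing.Theory Num.Theory.

(* Sumset and difference set of a finite set of integers given as a list
   (duplicates are irrelevant: we count distinct elements via undup). *)
Definition sumset (s : seq int) : seq int := undup [seq (x + y)%R | x <- s, y <- s].
Definition diffset (s : seq int) : seq int := undup [seq (x - y)%R | x <- s, y <- s].

Definition MSTD (s : seq int) : Prop := size (diffset s) < size (sumset s).

Definition to_ints n (S : {set 'I_n}) : seq int := [seq Posz (nat_of_ord i) | i <- enum S].

Definition Icc n (a b : nat) : {set 'I_n} := [set i : 'I_n | a <= i <= b].

Definition Lset n : {set 'I_n} := [set i : 'I_n | nat_of_ord i \in [:: 0; 2; 3; 7; 8; 9; 10]].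
Definition Rset n : {set 'I_n} :=
  [set i : 'I_n | nat_of_ord i \in [:: n-11; n-10; n-9; n-8; n-6; n-3; n-2; n-1]].

(* M is a subset of [11, n-12] such that every prefix [11, 10+k] and every
   suffix [n-11-k, n-12] (1 <= k <= n-22) has more than half of its k elements in M. *)
Definition goodM n (M : {set 'I_n}) : bool :=
  (M \subset Icc n 11 (n - 12)) &&
  [forall k : 'I_(n - 21), (1 <= k) ==>
     ((k < 2 * #|M :&: Icc n 11 (10 + k)|) &&
      (k < 2 * #|M :&: Icc n (n - 11 - k) (n - 12)|))].

Definition count_construction n : nat :=
  #|[set S : {set 'I_n} | [exists M : {set 'I_n}, goodM M && (S == Lset n :|: M :|: Rset n)]]|.

(* Main.v *)
Require Import Defs.
From mathcomp Require Import all_boot all_order all_algebra.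
From mathcomp Require Import zify ring.
Set Implicit Arguments. Unset Strict Implicit. Unset Printing Implicit Defensive.
Import Order.TTheory GRing.Theory Num.Theory.

(** MSTD: the fringes leave ±(n-7) out of S-S, so |S-S| <= 2n-3. Every sum in
    [0, 2n-2] except 1 occurs: the extreme ones come from the fringes alone, and
    for the others S contains more than half of an interval symmetric about s/2,
    hence a pair with sum s.

    Counting: good sets M are ±1 walks of length m = n-22 staying strictly above
    their start and strictly below their end. The first and the last 2p+1 steps
    (m = 4p+2+r, r < 4) are positive walks, of which there are C(2p,p) =
    O(4^p/sqrt p); this gives the upper bound. For the lower bound, glue two
    positive walks that stay below T = 4k+2 and end at height at least T/2. By
    reflection there are at least w_k - 2 w_(2k+1) of these, w_j = C(2p,p+j);
    taking k least with 4 w_k <= w_0, log-concavity gives 4 w_(2k+1) <= w_k,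
    while w_k is still at least w_0/12. *)

(** * Bit sequences *)

(** Growing at the right end makes the last step of a walk the one that a recursion on the length
    removes. *)
Fixpoint bitseqs (h : nat) : seq (seq bool) :=
  if h is h'.+1 then
    [seq rcons s true | s <- bitseqs h'] ++ [seq rcons s false | s <- bitseqs h']
  else [:: [::]].

Lemma mem_bitseqs h s : (s \in bitseqs h) = (size s == h).
Proof.
elim: h s => [|h IH] s; first by rewrite inE size_eq0.
rewrite /= mem_cat; case/lastP: s => [|s b].
  by apply/negbTE; rewrite negb_or; apply/andP; split;
    apply/mapP => -[] x _ /esym/eqP; rewrite -size_eq0 size_rcons.
have E c : (rcons s b \in [seq rcons s' c | s' <- bitseqs h]) = (size s == h) && (b == c).
  apply/mapP/andP => [[s' + /rcons_inj[-> ->]]|[hs /eqP ->]]; first by rewrite IH.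
  by exists s => //; rewrite IH.
by rewrite !E size_rcons eqSS -andb_orr; case: b E => _; rewrite andbT.
Qed.

Lemma bitseqs_uniq h : uniq (bitseqs h).
Proof.
elim: h => //= h IH.
rewrite cat_uniq !map_inj_uniq ?IH ?andbT; try exact: rcons_injl.
by apply/hasPn => _ /mapP[s _ ->]; apply/mapP => -[s' _ /rcons_inj[]].
Qed.

Lemma size_bitseqs h : size (bitseqs h) = 2 ^ h.
Proof. by elim: h => //= h IH; rewrite size_cat !size_map IH addnn -mul2n -expnS. Qed.

Lemma count_bitseqsS h (P : pred (seq bool)) :
  count P (bitseqs h.+1) =
  count (fun s => P (rcons s true)) (bitseqs h) + count (fun s => P (rcons s false)) (bitseqs h).
Proof. by rewrite /= count_cat !count_map. Qed.

Lemma sub_count_bitseqs h (P Q : pred (seq bool)) :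
  (forall s, size s = h -> P s -> Q s) ->
  count P (bitseqs h) <= count Q (bitseqs h).
Proof.
move=> H; have -> : count P (bitseqs h) = count (predI P Q) (bitseqs h).
  apply: eq_in_count => s; rewrite mem_bitseqs => /eqP hs /=.
  by case E: (P s) => //=; rewrite (H s hs E).
by apply: sub_count => s /andP[].
Qed.

Lemma eq_count_bitseqs h (P Q : pred (seq bool)) :
  (forall s, size s = h -> P s = Q s) ->
  count P (bitseqs h) = count Q (bitseqs h).
Proof. by move=> H; apply: eq_in_count => s; rewrite mem_bitseqs => /eqP /H. Qed.

Lemma count_bitseqs_rev h (P : pred (seq bool)) :
  count (fun s => P (rev s)) (bitseqs h) = count P (bitseqs h).
Proof.
rewrite -(count_map rev P); apply/permP/uniq_perm; rewrite ?bitseqs_uniq //.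
  by rewrite map_inj_uniq ?bitseqs_uniq //; exact: (can_inj revK).
move=> s; rewrite mem_bitseqs; apply/mapP/idP => [[t + ->]|hs].
  by rewrite mem_bitseqs size_rev.
by exists (rev s); rewrite ?revK // mem_bitseqs size_rev.
Qed.

(** The two blocks of bits vary independently; this turns separate conditions on the two ends of a
    walk into a product. *)
Lemma count_bitseqsD a b (P Q : pred (seq bool)) :
  count (fun s => P (take a s) && Q (drop a s)) (bitseqs (a + b)) =
  count P (bitseqs a) * count Q (bitseqs b).
Proof.
elim: b Q => [|b IH] Q.
  rewrite addn0 /= addn0; case E: (Q [::]).
    rewrite muln1; apply: eq_count_bitseqs => s hs.
    by rewrite -hs take_size drop_size E andbT.
  rewrite muln0 -(count_pred0 (bitseqs a)); apply: eq_count_bitseqs => s hs.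
  by rewrite -hs take_size drop_size E andbF.
rewrite addnS !count_bitseqsS mulnDr -!IH.
by congr (_ + _); apply: eq_count_bitseqs => s hs;
  rewrite drop_rcons ?hs ?leq_addr // -cats1 takel_cat // hs leq_addr.
Qed.

Lemma card_tuple_bitseqs h (P : pred (seq bool)) :
  #|[set t : h.-tuple bool | P t]| = count P (bitseqs h).
Proof.
rewrite cardsE cardE size_filter -(count_map val P).
apply/permP/uniq_perm; rewrite ?bitseqs_uniq //.
  by rewrite map_inj_uniq -?enumT ?enum_uniq //; exact: val_inj.
move=> s; rewrite mem_bitseqs; apply/mapP/idP => [[t _ ->]|hs]; first by rewrite size_tuple.
by exists (Tuple hs); rewrite // -enumT mem_enum.
Qed.

(** * Walks and the reflection principle *)

Definition height (s : seq bool) : int := (2 * (count id s)%:Z - (size s)%:Z)%R.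

(** Time 0 is exempt: a walk starts at height 0, where strict positivity fails. *)
Definition stays_in (D : pred int) (s : seq bool) : bool :=
  all (fun k => D (height (take k s))) (iota 1 (size s)).

Lemma height_rcons s b :
  height (rcons s b) = (height s + (if b then 1 else -1))%R.
Proof. by rewrite /height -cats1 count_cat size_cat /=; case: b => /=; lia. Qed.

Lemma height_cat s t : height (s ++ t) = (height s + height t)%R.
Proof. rewrite /height count_cat size_cat; lia. Qed.

Lemma stays_in_rcons (D : pred int) s b :
  stays_in D (rcons s b) = stays_in D s && D (height (rcons s b)).
Proof.
rewrite /stays_in size_rcons -[(size s).+1]addn1 iotaD all_cat /= andbT.
rewrite take_oversize ?size_rcons ?add1n //; congr (_ && _).
apply: eq_in_all => k; rewrite mem_iota => /andP[_ hk].
by rewrite -cats1 takel_cat //; lia.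
Qed.

Lemma stays_inP (D : pred int) s :
  reflect (forall k, 0 < k <= size s -> D (height (take k s))) (stays_in D s).
Proof.
apply: (iffP allP) => H k; first by move=> hk; apply: H; rewrite mem_iota; lia.
by rewrite mem_iota => hk; apply: H; lia.
Qed.

Definition num_walks (D : pred int) (h : nat) (a : int) : nat :=
  count (fun s => stays_in D s && (height s == a)) (bitseqs h).

Lemma num_walksS (D : pred int) h (a : int) :
  num_walks D h.+1 a = if D a then num_walks D h (a - 1)%R + num_walks D h (a + 1)%R else 0.
Proof.
rewrite /num_walks count_bitseqsS; case: ifPn => Da; last first.
  have E b : count (fun s => stays_in D (rcons s b) && (height (rcons s b) == a)) (bitseqs h) = 0.
    apply/eqP; rewrite -[_ == 0]negbK -lt0n -has_count; apply/hasPn => s _.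
    by apply/negP => /andP[+ /eqP Ea]; rewrite stays_in_rcons Ea (negbTE Da) andbF.
  by rewrite !E.
congr (_ + _); apply: eq_count => s /=; rewrite stays_in_rcons.
  have -> : (height s == a - 1)%R = (height (rcons s true) == a) by rewrite height_rcons; lia.
  by case: eqP => [->|_]; rewrite ?andbF ?Da ?andbT.
have -> : (height s == a + 1)%R = (height (rcons s false) == a) by rewrite height_rcons; lia.
by case: eqP => [->|_]; rewrite ?andbF ?Da ?andbT.
Qed.

Lemma num_walks0 D (a : int) : num_walks D 0 a = (a == 0%R).
Proof. by rewrite /num_walks /= addn0 /stays_in /= /height /= eq_sym. Qed.

(** Unrestricted walks from 0 to [x], by their last step. Values in [int] keep later differences
    free of truncation. *)
Fixpoint free_walks (h : nat) (x : int) : int :=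
  if h is h'.+1 then (free_walks h' (x - 1) + free_walks h' (x + 1))%R
  else Posz (x == 0%R).

Lemma free_walksN h (x : int) : free_walks h (- x)%R = free_walks h x.
Proof.
elim: h x => [|h IH] x /=; first by rewrite oppr_eq0.
rewrite addrC -(IH (x - 1)%R) -(IH (x + 1)%R).
by congr (free_walks h _ + free_walks h _)%R; lia.
Qed.

Lemma free_walks_low h (x : int) : (x < - h%:Z)%R -> free_walks h x = 0%R.
Proof.
elim: h x => [|h IH] x hx /=; first by have -> : (x == 0)%R = false by lia.
by rewrite !IH //; lia.
Qed.

(** A walk with [i] up steps ends at [2i - h], and the last-step recursion becomes Pascal's rule. *)
Lemma free_walks_bin h i : free_walks h (2 * i%:Z - h%:Z)%R = Posz 'C(h, i).
Proof.
elim: h i => [|h IH] [|i].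
- by rewrite bin0.
- by rewrite bin0n [LHS]/(free_walks _ _); case: eqP => //; lia.
- rewrite bin0 /= free_walks_low; last lia.
  by rewrite add0r -[1%N](bin0 h) -(IH 0); congr free_walks; lia.
rewrite binS /= PoszD -!IH addrC; congr (free_walks _ _ + free_walks _ _)%R; lia.
Qed.

(* The ballot theorem: positive walks of length [h.+1] ending at [a >= 0]. *)
Definition ballot_diff (h : nat) (a : int) : int :=
  (free_walks h (a - 1) - free_walks h (a + 1))%R.

Lemma ballot_diffS h (a : int) :
  ballot_diff h.+1 a = (ballot_diff h (a - 1) + ballot_diff h (a + 1))%R.
Proof.
rewrite /ballot_diff /= !(subrK, addrK).
lia.
Qed.

Lemma ballot_diff0 h : ballot_diff h 0%R = 0%R.
Proof. by rewrite /ballot_diff sub0r add0r free_walksN subrr. Qed.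

(** For [a > 0] both neighbours of [a] are again nonnegative, and at [a = 0] the symmetry of free
    walks gives 0, so the recursion propagates the sign. *)
Lemma ballot_diff_ge0 h (a : int) : (0 <= a)%R -> (0 <= ballot_diff h a)%R.
Proof.
elim: h a => [|h IH] a ha.
  rewrite /ballot_diff /=; case: (eqVneq (a - 1)%R 0%R); case: (eqVneq (a + 1)%R 0%R); lia.
have [->|a0] := eqVneq a 0%R; first by rewrite ballot_diff0.
by rewrite ballot_diffS addr_ge0 // IH; lia.
Qed.

Lemma ballot_diff_base (a : int) : (0 <= a)%R -> ballot_diff 0 a = Posz (a == 1%R).
Proof.
move=> ha; rewrite /ballot_diff /= subr_eq0.
have -> : (a + 1 == 0)%R = false by lia.
exact: subr0.
Qed.

Lemma num_walks1 (D : pred int) (a : int) :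
  (0 <= a)%R -> num_walks D 1 a = if D a then (a == 1%R) : nat else 0.
Proof.
move=> ha; rewrite num_walksS !num_walks0 subr_eq0.
have -> : (a + 1 == 0)%R = false by lia.
by rewrite addn0.
Qed.

(** The first step is forced up to 1, hence the shift from [h.+1] to [h]. Both sides obey the same
    recursion for [a > 0], vanish at 0 and agree at [h = 0]. *)
Lemma num_walks_pos h (a : int) : (0 <= a)%R ->
  Posz (num_walks (fun x => 0 < x)%R h.+1 a) = ballot_diff h a.
Proof.
elim: h a => [|h IH] a ha.
  rewrite num_walks1 // ballot_diff_base //; case: eqVneq => [->//|_]; by case: ifP.
rewrite num_walksS; case: ifPn => ha'.
  by rewrite PoszD !IH ?ballot_diffS //; lia.
have -> : a = 0%R by lia.
by rewrite ballot_diff0.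
Qed.

(* Reflection in the upper barrier [T]; stated as an inequality, it propagates
   through the step recursion without any bijection on walks. *)
Lemma num_walks_strip (T : int) h (a : int) : (1 < T)%R -> (0 <= a <= T)%R ->
  (ballot_diff h a - ballot_diff h (2 * T - a) <=
   (num_walks (fun x => 0 < x < T)%R h.+1 a)%:Z)%R.
Proof.
move=> hT; elim: h a => [|h IH] a ha.
  rewrite num_walks1 ?ballot_diff_base; try lia.
  have -> : (2 * T - a == 1)%R = false by lia.
  by case: eqVneq => [->|_]; [rewrite hT | case: ifP].
rewrite num_walksS; case: ifPn => ha'.
  have h1 := IH (a - 1)%R ltac:(lia).
  have h2 := IH (a + 1)%R ltac:(lia).
  rewrite !ballot_diffS PoszD.
  (* Reflection in [T] exchanges the two neighbours of [a]. *)
  have -> : (2 * T - a - 1 = 2 * T - (a + 1))%R by lia.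
  have -> : (2 * T - a + 1 = 2 * T - (a - 1))%R by lia.
  by apply: le_trans _ (lerD h1 h2); lia.
(* On the barriers no walk is counted, and the left side is at most 0: its first term vanishes at 0,
   and its two terms cancel at [T]. *)
have [->|a0] := eqVneq a 0%R.
  by rewrite ballot_diff0 sub0r oppr_le0; apply: ballot_diff_ge0; lia.
have -> : a = T by lia.
have -> : (2 * T - T = T)%R by lia.
by rewrite subrr.
Qed.

(** * Central binomial coefficients *)

Definition cbin (p j : nat) : nat := 'C(2 * p, p + j).

Lemma cbinS p j : (p + j + 1) * cbin p j.+1 = (p - j) * cbin p j.
Proof.
rewrite /cbin addn1 addnS; have := mul_bin_left (2 * p) (p + j).
have -> : 2 * p - (p + j) = p - j by lia.
by [].
Qed.

Lemma cbin_step p j : cbin p j.+1 <= cbin p j.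
Proof. have := cbinS p j; nia. Qed.

(** The ratio [(p - j) / (p + j + 1)] of consecutive terms decreases in [j], so a step at [i + j]
    loses at least the factor lost by the step at [j]. *)
Lemma cbin_log_concave p i j : cbin p (i + j) * cbin p 0 <= cbin p i * cbin p j.
Proof.
elim: j => [|j IH]; first by rewrite addn0.
have [hij|hij] := leqP p (i + j).
  by rewrite /cbin (@bin_small _ (p + (i + j.+1))) //; lia.
have := cbinS p (i + j); have := cbinS p j; rewrite -addnS.
move: (cbin p (i + j.+1)) (cbin p (i + j)) (cbin p j.+1) (cbin p j) (cbin p i) (cbin p 0) IH.
move=> X x Y y u v IH h1 h2.
rewrite -(@leq_pmul2l ((p + j + 1) * (p + (i + j) + 1))); last by lia.
have -> : (p + j + 1) * (p + (i + j) + 1) * (X * v) =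
          (p + j + 1) * v * ((p + (i + j) + 1) * X) by ring.
have -> : (p + j + 1) * (p + (i + j) + 1) * (u * Y) =
          (p + (i + j) + 1) * u * ((p + j + 1) * Y) by ring.
rewrite h1 h2.
have -> : (p + j + 1) * v * ((p - (i + j)) * x) = (p + j + 1) * (p - (i + j)) * (x * v) by ring.
have -> : (p + (i + j) + 1) * u * ((p - j) * y) = (p + (i + j) + 1) * (p - j) * (u * y) by ring.
by apply: leq_mul => //; apply: leq_mul; lia.
Qed.

(** The induction step reduces to [(p - j)(p + (j+1)^2) <= (p + j + 1)(p + j^2)]; for [j <= p] the
    two sides differ by [j(j+1)(2j+1)]. *)
Lemma cbin_decay p j : cbin p j * (p + j ^ 2) <= p * cbin p 0.
Proof.
elim: j => [|j IH]; first by rewrite addn0 mulnC.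
have [hj|hj] := leqP p j.
  by rewrite /cbin (@bin_small _ (p + j.+1)) //; lia.
have h := cbinS p j.
rewrite -(@leq_pmul2l (p + j + 1)); last by lia.
have -> : (p + j + 1) * (cbin p j.+1 * (p + j.+1 ^ 2)) =
   cbin p j * ((p - j) * (p + j.+1 ^ 2)) by rewrite mulnA h; ring.
apply: leq_trans (_ : cbin p j * ((p + j + 1) * (p + j ^ 2)) <= _).
  apply: leq_mul => //.
  have [q ->] : exists q, p = q + j by exists (p - j); lia.
  rewrite addnK; nia.
have -> : cbin p j * ((p + j + 1) * (p + j ^ 2)) = (p + j + 1) * (cbin p j * (p + j ^ 2)) by ring.
exact: leq_mul.
Qed.

Lemma cbin_threshold p : 14 <= p ->
  exists k, 4 * cbin p (2 * k).+1 <= cbin p k /\ cbin p 0 <= 12 * cbin p k.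
Proof.
move=> hp; have w0 : 0 < cbin p 0 by rewrite bin_gt0; lia.
have half : 4 * cbin p p./2 <= cbin p 0.
  have := cbin_decay p p./2.
  (* This makes [p + p./2 ^ 2] at least [4p] in the decay bound; [14 <= p] enters here. *)
  have : 3 * p <= p./2 ^ 2 by have := odd_double_half p; case: (odd p) => /=; nia.
  move: (p./2 ^ 2) => Q; nia.
case: (@ex_minnP (fun k => 4 * cbin p k <= cbin p 0)); first by exists p./2.
case=> [|k] hk kmin; first by lia.
have hk2 : k.+1 <= p./2 by apply: kmin.
have hprev : cbin p 0 < 4 * cbin p k by rewrite ltnNge; apply/negP => /kmin; lia.
(* As [k + 1 <= p/2], the ratio [(p - k) / (p + k + 1)] is at least 1/3. With minimality, this gives
   the factor [12 = 4 * 3]. *)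
have hstep : cbin p k <= 3 * cbin p k.+1 by have := cbinS p k; nia.
exists k.+1; split; last by lia.
have h1 := cbin_step p (2 * k.+1).
have := cbin_log_concave p k.+1 k.+1; rewrite addnn -mul2n => h2.
nia.
Qed.

Lemma cbin0S p : (p + 1) * cbin p.+1 0 = 2 * (2 * p + 1) * cbin p 0.
Proof.
rewrite /cbin !addn0 mulnS addSn add1n.
have := mul_bin_diag (2 * p).+2 p; have := mul_bin_down (2 * p).+1 p.
have -> : (2 * p).+1 - p = p.+1 by lia.
move=> /= h1 h2; nia.
Qed.

(** Squaring avoids square roots; the induction step reduces to [(2p+1)(2p+3) <= 4(p+1)^2]. *)
Lemma cbin0_upper p : cbin p 0 ^ 2 * (2 * p + 1) <= 16 ^ p.
Proof.
elim: p => [//|p IH]; have h := cbin0S p.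
rewrite -(@leq_pmul2l ((p + 1) ^ 2)); last by lia.
have -> : (p + 1) ^ 2 * (cbin p.+1 0 ^ 2 * (2 * p.+1 + 1)) =
   ((p + 1) * cbin p.+1 0) ^ 2 * (2 * p + 3) by ring.
rewrite h [16 ^ _]expnS.
have -> : (2 * (2 * p + 1) * cbin p 0) ^ 2 * (2 * p + 3) =
  (cbin p 0 ^ 2 * (2 * p + 1)) * (4 * (2 * p + 1) * (2 * p + 3)) by ring.
have -> : (p + 1) ^ 2 * (16 * 16 ^ p) = 16 ^ p * ((p + 1) ^ 2 * 16) by ring.
apply: leq_mul => //; nia.
Qed.

(** The induction starts from equality at [p = 1]; passing from [q] to [q + 1] reduces to
    [4q(q+1) <= (2q+1)^2]. *)
Lemma cbin0_lower p : 0 < p -> 16 ^ p <= cbin p 0 ^ 2 * (4 * p).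
Proof.
case: p => // p _; elim: p => [//|p IH]; have h := cbin0S p.+1.
rewrite -(@leq_pmul2l ((p.+1 + 1) ^ 2)); last by lia.
have -> : (p.+1 + 1) ^ 2 * (cbin p.+2 0 ^ 2 * (4 * p.+2)) =
   ((p.+1 + 1) * cbin p.+2 0) ^ 2 * (4 * p.+2) by ring.
rewrite h [16 ^ _]expnS.
have -> : (2 * (2 * p.+1 + 1) * cbin p.+1 0) ^ 2 * (4 * p.+2) =
  cbin p.+1 0 ^ 2 * (4 * (4 * (2 * p.+1 + 1) ^ 2 * p.+2)) by ring.
apply: leq_trans (_ : (p.+1 + 1) ^ 2 * (16 * (cbin p.+1 0 ^ 2 * (4 * p.+1))) <= _).
  by do 2 (apply: leq_mul => //).
have -> : (p.+1 + 1) ^ 2 * (16 * (cbin p.+1 0 ^ 2 * (4 * p.+1))) =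
  cbin p.+1 0 ^ 2 * ((p.+1 + 1) ^ 2 * (16 * (4 * p.+1))) by ring.
apply: leq_mul => //; nia.
Qed.

(** * Bidirectional ballot sequences *)

(** Walks of odd length [2p+1] end at odd heights. There the ballot difference is one of consecutive
    binomials, so sums over end heights telescope. *)
Lemma ballot_diff_cbin p j :
  ballot_diff (2 * p) (2 * j%:Z + 1)%R = (Posz (cbin p j) - Posz (cbin p j.+1))%R.
Proof.
rewrite /ballot_diff /cbin -!free_walks_bin.
by congr (free_walks _ _ - free_walks _ _)%R; lia.
Qed.

Lemma count_disjoint_split (T : eqType) (A B C : pred T) (l : seq T) :
  {in l, forall s, (A s : nat) = B s + C s} -> count A l = count B l + count C l.
Proof.
elim: l => //= x l IH H; rewrite H ?mem_head // IH; first by lia.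
by move=> s hs; apply: H; rewrite in_cons hs orbT.
Qed.

(** The window contains exactly [d] odd heights, [2i+1] to [2(i+d)-1], so telescoping is an
    induction on [d]. *)
Definition num_walks_between (D : pred int) (h i d : nat) : nat :=
  count (fun s => stays_in D s && (2 * i%:Z + 1 <= height s < 2 * (i + d)%:Z + 1)%R) (bitseqs h).

Lemma num_walks_between0 D h i : num_walks_between D h i 0 = 0.
Proof.
rewrite /num_walks_between addn0 -(count_pred0 (bitseqs h)); apply: eq_count => s /=.
by apply/negbTE; rewrite negb_and; apply/orP; right; lia.
Qed.

Lemma num_walks_betweenS D p i d :
  num_walks_between D (2 * p).+1 i d.+1 =
  num_walks_between D (2 * p).+1 i d + num_walks D (2 * p).+1 (2 * (i + d)%:Z + 1)%R.
Proof.
apply: count_disjoint_split => s; rewrite mem_bitseqs => /eqP hs.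
by case: (stays_in D s) => //=; rewrite /height hs; lia.
Qed.

Lemma num_pos_walks_between p i d :
  num_walks_between (fun x => 0 < x)%R (2 * p).+1 i d + cbin p (i + d) = cbin p i.
Proof.
elim: d => [|d IH]; first by rewrite num_walks_between0 addn0.
have /= := @num_walks_pos (2 * p) (2 * (i + d)%:Z + 1)%R ltac:(lia).
rewrite ballot_diff_cbin num_walks_betweenS addnS.
move: IH; move: (num_walks_between _ _ _ _) (num_walks _ _ _) => A B; lia.
Qed.

(** With [T = 4k+2], height [2(k+d)+1] reflects to [2(3k+1-d)+1]. Two sums telescope, one upwards
    from index [k], the other downwards from [3k+2]. *)
Lemma num_strip_walks_between p k d : d <= k.+1 ->
  cbin p k + cbin p (3 * k + 2) <=
  num_walks_between (fun x => 0 < x < 4 * k%:Z + 2)%R (2 * p).+1 k d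
  + cbin p (k + d) + cbin p (3 * k + 2 - d).
Proof.
elim: d => [|d IH] hd; first by rewrite num_walks_between0 addn0 subn0.
have /= := @num_walks_strip (4 * k%:Z + 2)%R (2 * p) (2 * (k + d)%:Z + 1)%R ltac:(lia) ltac:(lia).
have -> : (2 * (4 * k%:Z + 2) - (2 * (k + d)%:Z + 1) = 2 * (3 * k + 2 - d.+1)%:Z + 1)%R by lia.
rewrite !ballot_diff_cbin num_walks_betweenS (addnS k d).
have -> : (3 * k + 2 - d.+1).+1 = 3 * k + 2 - d by lia.
move: (IH (ltnW hd)); move: (num_walks_between _ _ _ _) (num_walks _ _ _) => A B; lia.
Qed.

Definition positive_walk (s : seq bool) : bool := stays_in (fun x => 0 < x)%R s.

Lemma count_positive_walk p : count positive_walk (bitseqs (2 * p).+1) <= cbin p 0.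
Proof.
(* This window covers the heights 1 to [2p+1], all those open to a positive walk of this length. *)
rewrite -(num_pos_walks_between p 0 p.+1); apply: leq_trans (leq_addr _ _).
apply: sub_count_bitseqs => s hs hpos; apply/andP; split=> //.
have := stays_inP _ _ hpos (size s); rewrite take_size hs leqnn => /(_ isT).
rewrite /height hs; have := count_size id s; rewrite hs; lia.
Qed.

Definition strip_walk (k : nat) (s : seq bool) : bool :=
  stays_in (fun x => 0 < x < 4 * k%:Z + 2)%R s && (2 * k%:Z + 1 <= height s)%R.

(** For [d = k+1] both telescoping sums stop at the same index [2k+1], and the window is the upper
    half of the strip. *)
Lemma count_strip_walk p k :
  cbin p k <= count (strip_walk k) (bitseqs (2 * p).+1) + 2 * cbin p (2 * k).+1.
Proof.
have := @num_strip_walks_between p k k.+1 (leqnn _).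
have -> : 3 * k + 2 - k.+1 = (2 * k).+1 by lia.
have -> : k + k.+1 = (2 * k).+1 by lia.
have : num_walks_between (fun x => 0 < x < 4 * k%:Z + 2)%R (2 * p).+1 k k.+1 <=
       count (strip_walk k) (bitseqs (2 * p).+1).
  by apply: sub_count => s /andP[h1 /andP[h2 _]]; apply/andP.
move: (num_walks_between _ _ _ _) => A; lia.
Qed.

Definition bidirectional (s : seq bool) : bool := positive_walk s && positive_walk (rev s).

Lemma stays_in_take (D : pred int) k s : stays_in D s -> stays_in D (take k s).
Proof.
move=> /stays_inP H; apply/stays_inP => i; rewrite size_take_min => hi.
by rewrite take_takel; [apply: H|]; lia.
Qed.

Lemma height_rev s : height (rev s) = height s.
Proof. by rewrite /height count_rev size_rev. Qed.

Lemma height_all_true s : all id s -> (0 <= height s)%R.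
Proof. by rewrite /height all_count => /eqP ->; lia. Qed.

(** After [x] the height is at least [T/2 = 2k+1], and [y] only climbs. Every suffix of [z] is a
    prefix of [rev z], hence rises by less than [T], while [z] rises by at least [T/2]; so a prefix
    of [z] descends by less than [T/2]. *)
Lemma positive_walk_cat k x y z :
  strip_walk k x -> all id y -> strip_walk k (rev z) -> positive_walk (x ++ y ++ z).
Proof.
move=> /andP[/stays_inP hx hx2] hy /andP[/stays_inP hz]; rewrite height_rev => hz2.
apply/stays_inP => i; rewrite !size_cat => hi.
have [ix|ix] := leqP i (size x).
  by rewrite takel_cat //; case/andP: (hx i ltac:(lia)).
rewrite take_cat ltnNge (ltnW ix) /= height_cat.
have [iy|iy] := leqP (i - size x) (size y).
  rewrite takel_cat //.
  have : all id (take (i - size x) y).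
    by apply/allP => b /mem_take hb; exact: (allP hy).
  move/height_all_true; lia.
rewrite take_cat ltnNge (ltnW iy) /= height_cat.
set j := i - size x - size y.
have := height_all_true hy; have : height z = (height (take j z) + height (drop j z))%R.
  by rewrite -height_cat cat_take_drop.
have [jz|jz] := leqP (size z) j.
  by rewrite (drop_oversize jz) /= {3}/height /=; lia.
have := hz (size z - j); rewrite size_rev -rev_drop height_rev => /(_ ltac:(lia)).
lia.
Qed.

(** Only the conditions on the first and the last [2p+1] steps are kept; the [r] middle steps are
    free. *)
Lemma count_bidirectional_upper p r :
  count bidirectional (bitseqs ((2 * p).+1 + (r + (2 * p).+1))) <= 2 ^ r * cbin p 0 ^ 2.
Proof.
set h := (2 * p).+1.
have -> : 2 ^ r * cbin p 0 ^ 2 = cbin p 0 * (2 ^ r * cbin p 0) by ring.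
apply: leq_trans (_ : count positive_walk (bitseqs h) *
  (count predT (bitseqs r) * count (fun s => positive_walk (rev s)) (bitseqs h)) <= _); last first.
  by rewrite count_bitseqs_rev count_predT size_bitseqs !leq_mul // count_positive_walk.
rewrite -!count_bitseqsD; apply: sub_count_bitseqs => s hs /andP[h1 h2] /=.
rewrite drop_drop rev_drop; apply/andP; split; exact: stays_in_take.
Qed.

(** The middle [r] steps all go up. The gluing hypotheses are invariant under reversal, so one
    gluing lemma gives positivity in both directions. *)
Lemma count_bidirectional_lower p r k :
  count (strip_walk k) (bitseqs (2 * p).+1) ^ 2 <=
  count bidirectional (bitseqs ((2 * p).+1 + (r + (2 * p).+1))).
Proof.
set h := (2 * p).+1.
apply: leq_trans (_ : count (strip_walk k) (bitseqs h) *
  (count (all id) (bitseqs r) * count (fun s => strip_walk k (rev s)) (bitseqs h)) <= _).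
  rewrite count_bitseqs_rev -mulnn leq_mul // leq_pmull // -has_count.
  by apply/hasP; exists (nseq r true); rewrite ?mem_bitseqs ?size_nseq // all_nseq orbT.
rewrite -!count_bitseqsD; apply: sub_count_bitseqs => s hs /andP[h1 /andP[h2 h3]].
rewrite /bidirectional -{1 2}(cat_take_drop h s) -{1 2}(cat_take_drop r (drop h s)).
rewrite !rev_cat -catA !(@positive_walk_cat k) ?revK ?all_rev //.
Qed.

Lemma bidirectional_asymptotics p r : 14 <= p ->
  let G := count bidirectional (bitseqs ((2 * p).+1 + (r + (2 * p).+1))) in
  16 ^ p <= 2304 * p * G /\ (2 * p + 1) * G <= 2 ^ r * 16 ^ p.
Proof.
move=> hp G; split; last first.
  have hG : G <= _ := count_bidirectional_upper p r.
  rewrite mulnC; apply: leq_trans (leq_mul hG (leqnn _)) _.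
  by rewrite -mulnA leq_mul // cbin0_upper.
have [k [hk1 hk2]] := cbin_threshold hp.
have hG : _ <= G := count_bidirectional_lower p r k.
have hN := count_strip_walk p k.
apply: leq_trans (cbin0_lower _) _; first by lia.
(* Subtracting [2 * cbin p (2 * k).+1] costs at most half of [cbin p k], which is at least 1/12 of
   [cbin p 0]. Then [576 = 24^2] and [2304 = 4 * 576]. *)
have h24 : cbin p 0 <= 24 * count (strip_walk k) (bitseqs (2 * p).+1) by lia.
have : cbin p 0 ^ 2 <= 576 * G.
  apply: leq_trans (_ : (24 * count (strip_walk k) (bitseqs (2 * p).+1)) ^ 2 <= _).
    by rewrite leq_sqr.
  by rewrite expnMn leq_mul.
have -> : 2304 * p * G = 576 * G * (4 * p) by lia.
by move=> hX; rewrite leq_mul.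
Qed.

(** * Good middle sets as bidirectional ballot sequences *)

Lemma card_ord_interval n a k (P : pred nat) : a + k <= n ->
  #|[set i : 'I_n | (a <= i < a + k) && P i]| = count P (iota a k).
Proof.
move=> hn; rewrite cardsE cardE size_filter -enumT.
rewrite -(count_map val (fun i => (a <= i < a + k) && P i)) val_enum_ord.
have -> : n = a + (k + (n - (a + k))) by lia.
rewrite !iotaD !count_cat add0n -[RHS]add0n -[RHS]addn0 addnA.
congr (_ + _ + _).
- rewrite (@eq_in_count _ _ pred0) ?count_pred0 // => i; rewrite mem_iota => hi /=.
  by apply/negbTE; lia.
- by apply: eq_in_count => i; rewrite mem_iota => hi /=; rewrite hi.
rewrite (@eq_in_count _ _ pred0) ?count_pred0 // => i; rewrite mem_iota => hi /=.
by apply/negbTE; lia.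
Qed.

Definition middle_set n (s : seq bool) : {set 'I_n} :=
  [set i : 'I_n | (11 <= i <= n - 12) && nth false s (i - 11)].

Lemma count_nth_iota (s : seq bool) a c k : a + k <= size s ->
  count (fun i => nth false s (i - c)) (iota (c + a) k) = count id (take k (drop a s)).
Proof.
move=> hk; rewrite iotaDl count_map -[X in take k (drop a X)](mkseq_nth false).
rewrite /mkseq -map_drop -map_take drop_iota take_iota count_map.
have -> : minn k (size s - a) = k by lia.
by apply: eq_count => i /=; rewrite addKn.
Qed.

Lemma card_middle_set n s a k : 24 <= n -> size s = n - 22 -> a + k <= n - 22 -> 0 < k ->
  #|middle_set n s :&: Icc n (11 + a) (10 + a + k)| = count id (take k (drop a s)).
Proof.
move=> hn hs hk k0; rewrite -(@count_nth_iota s a 11) ?hs // -(@card_ord_interval n); last by lia.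
apply: eq_card => i; rewrite !inE; case: (nth _ _ _); rewrite ?andbF ?andbT //=; lia.
Qed.

Lemma positive_walkE s :
  positive_walk s = [forall k : 'I_(size s).+1, (1 <= k) ==> (k < 2 * count id (take k s))].
Proof.
apply/stays_inP/forallP => H k.
  have hk : k <= size s by rewrite -ltnS.
  by apply/implyP => k1; have := H k; rewrite k1 hk /height size_takel // => /(_ isT); lia.
move=> hk; have := H (inord k); rewrite inordK; last by lia.
by rewrite /height size_takel; [move/implyP|]; lia.
Qed.

(** A majority in a prefix of length [k] says that the walk is positive at time [k]; suffixes are
    the prefixes of the reversed walk. *)
Lemma goodM_middle_set n s : 24 <= n -> size s = n - 22 ->
  goodM (middle_set n s) = bidirectional s.
Proof.
move=> hn hs; rewrite /goodM /bidirectional !positive_walkE size_rev hs.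
have -> : middle_set n s \subset Icc n 11 (n - 12).
  by apply/subsetP => i; rewrite !inE => /andP[].
rewrite /=; have E : (n - 22).+1 = n - 21 by lia.
have P1 k : 0 < k < n - 21 -> #|middle_set n s :&: Icc n 11 (10 + k)| = count id (take k s).
  move=> hk; rewrite -{2}(drop0 s) -(@card_middle_set n s 0 k) //; lia.
have P2 k : 0 < k < n - 21 ->
    #|middle_set n s :&: Icc n (n - 11 - k) (n - 12)| = count id (take k (rev s)).
  move=> hk; rewrite take_rev count_rev hs -(@take_oversize _ k (drop _ s)); last first.
    by rewrite size_drop hs; lia.
  rewrite -(@card_middle_set n s (n - 22 - k) k) //; try lia.
  by congr #|pred_of_set (_ :&: Icc n _ _)|; lia.
apply/forallP/andP => [H|[/forallP H1 /forallP H2] k].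
  split; apply/forallP => k; apply/implyP => k0;
    have := H (cast_ord E k); rewrite /= k0 P1 ?P2 ?k0 -?E //=; by case/andP.
apply/implyP => k0; rewrite P1 ?P2 ?k0 ?ltn_ord //.
have := H1 (cast_ord (esym E) k); have := H2 (cast_ord (esym E) k).
by rewrite /= k0 /= => -> ->.
Qed.

Lemma goodM_eq_middle_set n (M : {set 'I_n}) : 24 <= n -> goodM M ->
  exists2 t : (n - 22).-tuple bool, bidirectional t & M = middle_set n t.
Proof.
(* The successor form makes the ordinal type inhabited, as [inord] requires. *)
case: n M => // n M hn hM.
pose t := [tuple inord (i + 11) \in M | i < n.+1 - 22].
have EM : M = middle_set n.+1 t.
  apply/setP => i; rewrite inE; case: (boolP (11 <= i <= _)) => hi /=.
    have hi' : i - 11 < n.+1 - 22 by lia.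
    have -> : nth false t (i - 11) = tnth t (Ordinal hi') by rewrite (tnth_nth false).
    rewrite tnth_mktuple /=.
    by congr (_ \in M); apply/val_inj; rewrite /= inordK; lia.
  apply/negP => iM; case/andP: hM => /subsetP/(_ i iM); rewrite inE => hi2 _.
  by rewrite hi2 in hi.
by exists t => //; rewrite -(goodM_middle_set hn) ?size_tuple // -EM.
Qed.

(** The fringes do not meet the middle interval, so the union determines the middle; counting sets
    [S] is counting walks. *)
Lemma middle_set_inj n (s t : (n - 22).-tuple bool) : 24 <= n ->
  Lset n :|: middle_set n s :|: Rset n = Lset n :|: middle_set n t :|: Rset n -> s = t.
Proof.
move=> hn /setP E; apply: eq_from_tnth => i; have := ltn_ord i => hi.
have hi' : i + 11 < n by lia.
have notL : i + 11 \notin [:: 0; 2; 3; 7; 8; 9; 10].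
  by rewrite !inE !negb_or; do !(apply/andP; split); lia.
have notR : i + 11 \notin [:: n-11; n-10; n-9; n-8; n-6; n-3; n-2; n-1].
  by rewrite !inE !negb_or; do !(apply/andP; split); lia.
have := E (Ordinal hi'); rewrite 10!in_set /= (negbTE notL) (negbTE notR) /= !orbF.
have -> : 10 < i + 11 <= n - 12 by lia.
by rewrite addnK !(tnth_nth false).
Qed.

Lemma count_construction_bidirectional n : 24 <= n ->
  count_construction n = count bidirectional (bitseqs (n - 22)).
Proof.
move=> hn; rewrite -card_tuple_bitseqs /count_construction.
rewrite -(@card_in_imset _ _ (fun t : (n - 22).-tuple bool =>
  Lset n :|: middle_set n t :|: Rset n)); last by move=> s t _ _; exact: middle_set_inj.
apply: eq_card => S; rewrite inE; apply/existsP/imsetP.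
  move=> [M /andP[/(goodM_eq_middle_set hn)[t ht ->] /eqP ->]].
  by exists t; rewrite ?inE.
move=> [t]; rewrite inE => ht ->; exists (middle_set n t).
by rewrite eqxx goodM_middle_set ?size_tuple // ht.
Qed.

(** * Sums and differences *)

(** Pigeonhole: the reflection [f] permutes the interval, so [P] and its reflected copy, each
    holding on more than half of it, share a point. *)
Lemma majority_pair_sum (P : pred nat) a l : l < 2 * count P (iota a l) ->
  exists i j, [/\ P i, P j, i + j = 2 * a + l - 1 & i < a + l /\ j < a + l].
Proof.
move=> hl; pose f i := 2 * a + l - 1 - i.
have perm_f : perm_eq (map f (iota a l)) (iota a l).
  apply: uniq_perm; rewrite ?iota_uniq //.
    by rewrite map_inj_in_uniq ?iota_uniq // => x y; rewrite !mem_iota /f; lia.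
  move=> x; rewrite mem_iota; apply/mapP/idP => [[y]|hx].
    by rewrite mem_iota /f; lia.
  by exists (f x); rewrite ?mem_iota /f; lia.
have hf : count (preim f P) (iota a l) = count P (iota a l).
  by rewrite -count_map; exact/permP.
have := count_predUI P (preim f P) (iota a l).
have := count_size (predU P (preim f P)) (iota a l); rewrite size_iota hf => h1 h2.
have : has (predI P (preim f P)) (iota a l) by rewrite has_count; lia.
case/hasP => i; rewrite mem_iota => hi /andP[Pi Pfi].
by exists i, (f i); split => //; rewrite /f; lia.
Qed.

Definition Lnat : seq nat := [:: 0; 2; 3; 7; 8; 9; 10].
(* The right fringe translated by [-(n - 11)]. *)
Definition Rnat : seq nat := [:: 0; 1; 2; 3; 5; 8; 9; 10].

Lemma Lnat_sums s : s <= 20 -> s != 1 ->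
  exists i j, [/\ i \in Lnat, j \in Lnat & i + j = s].
Proof.
have : all (fun s => (s != 1) ==> (s \in [seq i + j | i <- Lnat, j <- Lnat])) (iota 0 21) by [].
move=> /allP H hs s1; have := H s; rewrite mem_iota s1 => /(_ hs) /allpairsP[[i j] [hi hj ->]].
by exists i, j.
Qed.

Lemma Rnat_sums s : s <= 20 -> exists i j, [/\ i \in Rnat, j \in Rnat & i + j = s].
Proof.
have : all (fun s => s \in [seq i + j | i <- Rnat, j <- Rnat]) (iota 0 21) by [].
move=> /allP H hs; have := H s; rewrite mem_iota => /(_ hs) /allpairsP[[i j] [hi hj ->]].
by exists i, j.
Qed.

Lemma fringe_majority_sums (P : pred nat) n : 24 <= n ->
  {in Lnat, forall i, P i} -> {in Rnat, forall i, P (n - 11 + i)} ->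
  (forall k, 0 < k <= n - 22 -> k < 2 * count P (iota 11 k)) ->
  (forall k, 0 < k <= n - 22 -> k < 2 * count P (iota (n - 11 - k) k)) ->
  forall s, s <= 2 * n - 2 -> s != 1 ->
  exists i j, [/\ P i, P j, i + j = s & i < n /\ j < n].
Proof.
move=> hn hL hR hpre hsuf s hs s1.
have cL a l : count (mem Lnat) (iota a l) <= count P (iota a l) by apply: sub_count.
have cR l : count (mem Rnat) (iota 0 l) <= count P (iota (n - 11) l).
  by rewrite -[n - 11]addn0 iotaDl count_map; apply: sub_count.
have cL11 : 7 <= count P (iota 0 11) := cL 0 11.
have cR11 : 8 <= count P (iota (n - 11) 11) := cR 11.
have cM := hpre (n - 22) ltac:(lia).
suff: exists a l, [/\ l < 2 * count P (iota a l), 2 * a + l - 1 = s & a + l <= n] \/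
      exists i j, [/\ P i, P j, i + j = s & i < n /\ j < n].
  case=> a [l [[/majority_pair_sum[i [j [Pi Pj Es hij]]] Es' hal]|//]].
  by exists i, j; split => //; lia.
have [s20|s20] := leqP s 20.
  have [i [j [/[dup] hi /hL Pi /[dup] hj /hL Pj Es]]] := Lnat_sums s20 s1.
  (* The two zeros are placeholders; only the first alternative uses the interval. *)
  exists 0, 0; right; exists i, j; split=> //.
  by move: hi hj; rewrite !inE; lia.
have [sb|sb] := leqP (2 * n - 22) s.
  have [i [j [/[dup] hi /hR Pi /[dup] hj /hR Pj Es]]] :=
    @Rnat_sums (s - (2 * n - 22)) ltac:(lia).
  exists 0, 0; right; exists (n - 11 + i), (n - 11 + j); split=> //; first by lia.
  by move: hi hj; rewrite !inE; lia.
have [c1|c1] := leqP s (n - 12).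
  exists 0, s.+1; left; split; [|lia|lia].
  have -> : s.+1 = 11 + (s - 10) by lia.
  by rewrite iotaD add0n count_cat; have := hpre (s - 10) ltac:(lia); lia.
have [c2|c2] := leqP s (n - 1).
  exists 0, s.+1; left; split; [|lia|lia].
  have [j [hj ->]] : exists j, j <= 10 /\ s = n - 11 + j by exists (s - (n - 11)); lia.
  have -> : (n - 11 + j).+1 = 11 + (n - 22 + j.+1) by lia.
  rewrite !iotaD !count_cat.
  rewrite add0n; have -> : 11 + (n - 22) = n - 11 by lia.
  (* The 3 is the surplus [2 * 7 - 11] of the full left fringe; the surplus of the middle, at least
     1, absorbs the extra point in [j.+1]. *)
  suff : j < 2 * count (mem Rnat) (iota 0 j.+1) + 3 by have := cR j.+1; lia.
  by do 11 (case: j hj => [//|j hj]).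
have [c3|c3] := leqP (n + 10) s.
  exists (s - n + 1), (2 * n - 1 - s); left; split; [|lia|lia].
  pose k := 2 * n - 2 - s - 10.
  have -> : s - n + 1 = n - 11 - k by lia.
  have -> : 2 * n - 1 - s = k + 11 by lia.
  rewrite iotaD count_cat; have := hsuf k ltac:(lia).
  have -> : n - 11 - k + k = n - 11 by lia.
  lia.
exists (s - n + 1), (2 * n - 1 - s); left; split; [|lia|lia].
have [j [hj ->]] : exists j, j <= 9 /\ s = n + 9 - j by exists (n + 9 - s); lia.
have -> : n + 9 - j - n + 1 = 10 - j by lia.
have -> : 2 * n - 1 - (n + 9 - j) = j.+1 + (n - 22 + 11) by lia.
rewrite !iotaD !count_cat.
have -> : 10 - j + j.+1 = 11 by lia.
have -> : 11 + (n - 22) = n - 11 by lia.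
(* Likewise, 5 is the surplus [2 * 8 - 11] of the full right fringe. *)
suff : j < 2 * count (mem Lnat) (iota (10 - j) j.+1) + 5 by have := cL (10 - j) j.+1; lia.
by do 10 (case: j hj => [//|j hj]).
Qed.

(** * The constructed set and its MSTD property *)

Definition constructed n (s : seq bool) : pred nat := fun i =>
  [|| i \in Lnat, (11 <= i <= n - 12) && nth false s (i - 11) |
      i \in [:: n-11; n-10; n-9; n-8; n-6; n-3; n-2; n-1]].

Lemma mem_to_ints n s x :
  reflect (exists2 i, i < n & constructed n s i /\ x = Posz i)
          (x \in to_ints (Lset n :|: middle_set n s :|: Rset n)).
Proof.
apply: (iffP mapP) => [[i]|[i hi [Pi ->]]].
  rewrite mem_enum => hi ->; exists (val i); [exact: ltn_ord | split=> //].
  by move: hi; rewrite 5!in_set /constructed -orbA.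
exists (Ordinal hi) => //; rewrite mem_enum.
by move: Pi; rewrite 5!in_set /constructed -orbA.
Qed.

Lemma bidirectional_constructed n s : 24 <= n -> size s = n - 22 -> bidirectional s ->
  forall k, 0 < k <= n - 22 ->
    k < 2 * count (constructed n s) (iota 11 k) /\
    k < 2 * count (constructed n s) (iota (n - 11 - k) k).
Proof.
move=> hn hs /andP[]; rewrite !positive_walkE => /forallP H1 /forallP H2 k hk.
have cM a : a + k <= n - 22 ->
    count id (take k (drop a s)) <= count (constructed n s) (iota (11 + a) k).
  move=> hak; rewrite -(@count_nth_iota s a 11) ?hs //.
  rewrite (@eq_in_count _ _ (fun i => (11 <= i <= n - 12) && nth false s (i - 11))).
    by apply: sub_count => i hi; rewrite /constructed hi orbT.
  by move=> i; rewrite mem_iota => hi; have -> : 11 <= i <= n - 12 by lia.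
split.
  have := H1 (inord k); rewrite inordK ?hs; last by lia.
  by have := cM 0 ltac:(lia); rewrite drop0 addn0; lia.
have := H2 (inord k); rewrite inordK ?size_rev ?hs; last by lia.
rewrite take_rev count_rev hs -(@take_oversize _ k (drop _ s)); last first.
  by rewrite size_drop hs; lia.
have := cM (n - 22 - k) ltac:(lia).
have -> : 11 + (n - 22 - k) = n - 11 - k by lia.
lia.
Qed.

(** Since [i < n], [j] is at most 6, hence 0, 2 or 3; then [i] would be [n-7], [n-5] or [n-4], none
    of which lies in the set. *)
Lemma constructed_no_gap n s i j : 24 <= n -> i < n ->
  constructed n s i -> constructed n s j -> i <> j + (n - 7).
Proof.
move=> hn hi Pi Pj Eij; have j6 : j < 7 by lia.
have {Pj} : j \in [:: 0; 2; 3].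
  case/or3P: Pj => [|/andP[]|]; [|lia|]; rewrite !inE; lia.
rewrite !inE => /or3P j023; move: Pi; rewrite Eij.
by case: j023 => /eqP -> /or3P[|/andP[]|]; rewrite ?inE; lia.
Qed.

Lemma constructed_MSTD n (M : {set 'I_n}) : 24 <= n -> goodM M ->
  MSTD (to_ints (Lset n :|: M :|: Rset n)).
Proof.
move=> hn /(goodM_eq_middle_set hn)[s hbi ->].
have hsz := size_tuple s; have hM := bidirectional_constructed hn hsz hbi.
rewrite /MSTD; set S := to_ints _.
have sums : 2 * n - 2 <= size (sumset S).
  pose full := map Posz (iota 0 (2 * n - 1)).
  have ufull : uniq full by rewrite map_inj_uniq ?iota_uniq // => x y [].
  have -> : 2 * n - 2 = size (rem (Posz 1) full).
    rewrite size_rem ?size_map ?size_iota; first by lia.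
    by apply: map_f; rewrite mem_iota; lia.
  apply: uniq_leq_size; first exact: rem_uniq.
  move=> x; rewrite mem_rem_uniq // inE => /andP[x1 /mapP[t]].
  rewrite mem_iota => ht Ex; rewrite Ex in x1 *.
  have [||||||i [j [Pi Pj <- [hi hj]]]] := @fringe_majority_sums (constructed n s) n hn _ _ _ _ t.
  - by move=> i hi; rewrite /constructed hi.
  - move=> i hi; apply/or3P/Or33; move: i hi; apply/allP => /=.
    by do !(apply/andP; split) => //; rewrite !inE; lia.
  - by move=> k /hM[].
  - by move=> k /hM[].
  - lia.
  - exact: x1.
  rewrite mem_undup PoszD; apply: (allpairs_f (fun x y => (x + y)%R)).
    by apply/mem_to_ints; exists i.
  by apply/mem_to_ints; exists j.
suff diffs : size (diffset S) <= 2 * n - 3 by lia.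
(* The interval from [-(n-1)] to [n-1], from which [n-7] and its negative are then removed. *)
pose full := [seq (Posz i - Posz (n - 1))%R | i <- iota 0 (2 * n - 1)].
have ufull : uniq full by rewrite map_inj_uniq ?iota_uniq // => x y /addIr[].
have memfull x : (- (Posz n) < x < Posz n)%R -> x \in full.
  move=> hx; apply/mapP; exists `|(x + Posz (n - 1))%R|%N; first by rewrite mem_iota; lia.
  by lia.
pose c : int := Posz (n - 7).
have -> : 2 * n - 3 = size (rem (- c)%R (rem c full)).
  rewrite !size_rem ?size_map ?size_iota; [lia| |].
    by apply: memfull; lia.
  by rewrite mem_rem_uniq // inE memfull ?andbT; rewrite /c; lia.
apply: uniq_leq_size; first exact: undup_uniq.
move=> x; rewrite mem_undup => /allpairsP[[u v] /= [/mem_to_ints[i hi [Pi ->]] /mem_to_ints[j hj [Pj ->]] ->]].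
rewrite mem_rem_uniq ?rem_uniq // inE mem_rem_uniq // inE memfull ?andbT; last by lia.
have := constructed_no_gap hn hi Pi Pj; have := constructed_no_gap hn hj Pj Pi.
by rewrite /c; lia.
Qed.

(** * Order of growth of the count *)

Lemma count_construction_theta n : 80 <= n ->
  2 ^ n <= 2304 * 2 ^ 27 * (n * count_construction n) /\
  n * count_construction n <= 27 * 2 ^ n.
Proof.
move=> hn; rewrite count_construction_bidirectional; last by lia.
(* From [n - 22 = 4p + 2 + r]; [80 <= n] is what gives [14 <= p]. The factor [2^27] below bounds
   [2^24 * 2^r]. *)
pose p := (n - 24) %/ 4; pose r := (n - 24) %% 4.
have hpr : n - 24 = p * 4 + r := divn_eq _ _.
have hr : r < 4 by rewrite ltn_mod.
have -> : n - 22 = (2 * p).+1 + (r + (2 * p).+1) by lia.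
have [] := @bidirectional_asymptotics p r ltac:(lia).
move: (count _ _) => G h1 h2.
have En : 2 ^ n = 2 ^ 24 * 2 ^ r * 16 ^ p.
  by rewrite -[16]/(2 ^ 4) -expnM -!expnD; congr (2 ^ _); lia.
have hr3 : 2 ^ r <= 2 ^ 3 by rewrite leq_exp2l.
split.
  rewrite En [2 ^ 27](expnD 2 24 3); move: (2 ^ 24) (2 ^ 3) hr3 => X Y hr3.
  apply: leq_trans (_ : X * Y * (2304 * p * G) <= _).
    by rewrite !leq_mul.
  have -> : 2304 * (X * Y) * (n * G) = X * Y * (2304 * n * G) by ring.
  by rewrite !leq_mul //; lia.
(* Here [n = 4p + r + 24 <= 4p + 27 <= 27 * (2p + 1)]. *)
apply: leq_trans (_ : 27 * ((2 * p + 1) * G) <= _).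
  by rewrite mulnA leq_mul //; lia.
rewrite leq_mul // (leq_trans h2) // En -mulnA leq_pmull // expn_gt0.
Qed.

Theorem theorem2 :
  (forall (n : nat), 24 <= n -> forall M : {set 'I_n}, goodM M ->
     MSTD (to_ints (Lset n :|: M :|: Rset n))) /\
  (exists (c1 c2 : rat) (N : nat), (0 < c1)%R /\ (0 < c2)%R /\
     forall n : nat, N <= n ->
       (c1 * (2 ^ n)%:R / n%:R <= (count_construction n)%:R)%R /\
       ((count_construction n)%:R <= c2 * (2 ^ n)%:R / n%:R)%R).
Proof.
split; first by move=> n hn M; exact: constructed_MSTD.
(* The constants stay abstract during the passage to [rat], as [K1] is huge as a unary numeral. *)
have [K1 [K2 [K1_gt0 K2_gt0 theta]]] : exists K1 K2, [/\ 0 < K1, 0 < K2 &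
    forall n, 80 <= n -> 2 ^ n <= K1 * (n * count_construction n) /\
                         n * count_construction n <= K2 * 2 ^ n].
  exists (2304 * 2 ^ 27), 27; split; [by rewrite muln_gt0 expn_gt0 | by [] |].
  exact: count_construction_theta.
exists (K1%:R^-1)%R, K2%:R%R, 80; split; [|split].
- by rewrite invr_gt0 ltr0n.
- by rewrite ltr0n.
move=> n hn; have [h1 h2] := theta n hn.
have n0 : (0 < n%:R :> rat)%R by rewrite ltr0n; lia.
split.
  rewrite ler_pdivrMr // ler_pdivrMl ?ltr0n // -!natrM ler_nat.
  by rewrite [count_construction n * n]mulnC.
by rewrite ler_pdivlMr // -!natrM ler_nat [count_construction n * n]mulnC.
Qed.
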